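(* Let $\Gamma\subseteq\Sigma$ be alphabets, $H$ a set of hypotheses over $\Sigma$ and $H'$ a set of hypotheses over $\Gamma$. Suppose $H$ reduces to $H'$. If $\mathsf{KA}_{H'}$ is complete, then so is $\mathsf{KA}_H$.
   Context: Regular expressions $T(X)$ over an alphabet $X$: $e,f::=e+f\mid e\cdot f\mid e^*\mid 0\mid 1\mid a$ ($a\in X$), with usual language $\llbracket e\rrbracket$. Kleene algebra axioms: idempotent semiring axioms plus $1+xx^*\le x^*$, $x+yz\le z\Rightarrow y^*x\le z$, $x+yz\le y\Rightarrow xz^*\le y$. A hypothesis is a pair of regular expressions $e\le f$. $\mathsf{KA}_H\vdash e=f$ means derivable in equational logic from all instances of the Kleene algebra axioms and the hypotheses in $H$, letters being constants (no substitution rule); $\mathsf{KA}_H\vdash H'$ means $\mathsf{KA}_H\vdash e\le f$ for all $e\le f\in H'$. The $H$-closure $H^\star(L)$ is the smallest language containing $L$ such that for all $e\le f\in H$ and words $u,v$, $u\llbracket f\rrbracket v\subseteq H^\star(L)$ implies $u\llbracket e\rrbracket v\subseteq H^\star(L)$. $\mathsf{KA}_H$ is complete if for all expressions $e,f$ (over its alphabet), $H^\star(\llbracket e\rrbracket)=H^\star(\llbracket f\rrbracket)$ implies $\mathsf{KA}_H\vdash e=f$. $H$ reduces to $H'$ if (1) $\mathsf{KA}_H\vdash H'$ and there is a map $r:T(\Sigma)\to T(\Gamma)$ such that for all $e\in T(\Sigma)$: (2) $\mathsf{KA}_H\vdash e=r(e)$, and (3) $H^\star(\llbracket e\rrbracket)\cap\Gamma^*\subseteq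 H'^\star(\llbracket r(e)\rrbracket)$. *)

(* Defs.v *)
From mathcomp Require Import all_boot.
From mathcomp Require Import boolp classical_sets.
Set Implicit Arguments.
Unset Strict Implicit.
Unset Printing Implicit Defensive.
Local Open Scope classical_set_scope.

Declare Scope regexp_scope.
Delimit Scope regexp_scope with re.

Inductive regexp (X : Type) : Type :=
| Plus of regexp X & regexp X
| Dot of regexp X & regexp X
| Star of regexp X
| Zero
| One
| Letter of X.

Arguments Zero {X}.
Arguments One {X}.
Bind Scope regexp_scope with regexp.

Notation "e + f" := (Plus e f) : regexp_scope.
Notation "e * f" := (Dot e f) : regexp_scope.
Notation "0" := Zero : regexp_scope.
Notation "1" := One : regexp_scope.

Fixpoint regexp_map (X Y : Type) (h : X -> Y) (e : regexp X) : regexp Y :=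
  match e with
  | Plus e1 e2 => Plus (regexp_map h e1) (regexp_map h e2)
  | Dot e1 e2 => Dot (regexp_map h e1) (regexp_map h e2)
  | Star e1 => Star (regexp_map h e1)
  | Zero => Zero
  | One => One
  | Letter a => Letter (h a)
  end.

Definition language (X : Type) := set (seq X).

Definition lang_cat (X : Type) (L M : language X) : language X :=
  [set u ++ v | u in L & v in M].

Definition lang_star (X : Type) (L : language X) : language X :=
  \bigcup_n iter n (lang_cat L) [set [::]].

Fixpoint lang (X : Type) (e : regexp X) : language X :=
  match e with
  | Plus e1 e2 => lang e1 `|` lang e2
  | Dot e1 e2 => lang_cat (lang e1) (lang e2)
  | Star e1 => lang_star (lang e1)
  | Zero => set0
  | One => [set [::]]
  | Letter a => [set [:: a]]
  end.

(* A pair (e, f) stands for the hypothesis e <= f. *)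
Definition hypotheses (X : Type) := set (regexp X * regexp X).

(* Provable equality in KA_H. An inequation x <= y abbreviates x + y = y.
   There is no substitution rule: the axioms are schemes over all
   expressions, while the members of H are taken as they are. *)
Inductive ka_eq (X : Type) (H : hypotheses X) :
    regexp X -> regexp X -> Prop :=
| ka_refl x : ka_eq H x x
| ka_sym x y : ka_eq H x y -> ka_eq H y x
| ka_trans x y z : ka_eq H x y -> ka_eq H y z -> ka_eq H x z
| ka_plus_congr x x' y y' :
    ka_eq H x x' -> ka_eq H y y' -> ka_eq H (x + y) (x' + y')
| ka_dot_congr x x' y y' :
    ka_eq H x x' -> ka_eq H y y' -> ka_eq H (x * y) (x' * y')
| ka_star_congr x x' : ka_eq H x x' -> ka_eq H (Star x) (Star x')
| ka_plusA x y z : ka_eq H (x + (y + z)) ((x + y) + z)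
| ka_plusC x y : ka_eq H (x + y) (y + x)
| ka_plusx0 x : ka_eq H (x + 0) x
| ka_plusxx x : ka_eq H (x + x) x
| ka_dotA x y z : ka_eq H (x * (y * z)) ((x * y) * z)
| ka_dot1x x : ka_eq H (1 * x) x
| ka_dotx1 x : ka_eq H (x * 1) x
| ka_dot0x x : ka_eq H (0 * x) 0
| ka_dotx0 x : ka_eq H (x * 0) 0
| ka_dotDl x y z : ka_eq H ((x + y) * z) (x * z + y * z)
| ka_dotDr x y z : ka_eq H (x * (y + z)) (x * y + x * z)
| ka_star_unfold x : ka_eq H ((1 + x * Star x) + Star x) (Star x)
| ka_star_indl x y z :
    ka_eq H ((x + y * z) + z) z -> ka_eq H (Star y * x + z) z
| ka_star_indr x y z :
    ka_eq H ((x + y * z) + y) y -> ka_eq H (x * Star z + y) y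
| ka_hyp e f : H (e, f) -> ka_eq H (e + f) f.

Definition ka_le (X : Type) (H : hypotheses X) (e f : regexp X) : Prop :=
  ka_eq H (e + f) f.

Definition closed_under (X : Type) (H : hypotheses X) (M : language X) : Prop :=
  forall e f, H (e, f) -> forall u v : seq X,
    [set u ++ w ++ v | w in lang f] `<=` M ->
    [set u ++ w ++ v | w in lang e] `<=` M.

Definition hyp_closure (X : Type) (H : hypotheses X) (L : language X) :
    language X :=
  smallest (closed_under H) L.

Definition ka_complete (X : Type) (H : hypotheses X) : Prop :=
  forall e f : regexp X,
    hyp_closure H (lang e) = hyp_closure H (lang f) -> ka_eq H e f.

(* A subalphabet Gamma of Sigma is also an alphabet in its own right (the type
   set_type Gamma); the next three definitions are the inclusions of T(Gamma)
   into T(Sigma) and of languages over Gamma into languages over Sigma, and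
   Gamma^* as a language over Sigma. *)
Definition regexp_incl (Sigma : Type) (Gamma : set Sigma) :
    regexp (set_type Gamma) -> regexp Sigma :=
  regexp_map (val : set_type Gamma -> Sigma).

Definition lang_incl (Sigma : Type) (Gamma : set Sigma)
    (L : language (set_type Gamma)) : language Sigma :=
  [set map (val : set_type Gamma -> Sigma) w | w in L].

Definition words_over (Sigma : Type) (Gamma : set Sigma) : language Sigma :=
  lang_star [set [:: a] | a in Gamma].

Definition reduces (Sigma : Type) (Gamma : set Sigma)
    (H : hypotheses Sigma) (H' : hypotheses (set_type Gamma)) : Prop :=
  (forall e f, H' (e, f) -> ka_le H (regexp_incl e) (regexp_incl f)) /\
  exists r : regexp Sigma -> regexp (set_type Gamma),
    forall e : regexp Sigma,
      ka_eq H e (regexp_incl (r e)) /\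
      hyp_closure H (lang e) `&` words_over Gamma
        `<=` lang_incl (hyp_closure H' (lang (r e))).

(* Main.v *)
Require Import Defs.
From mathcomp Require Import all_boot.
From mathcomp Require Import boolp classical_sets.

(* Soundness: every H-closed language M is stable under derivable inequations
   in context.  As H' is derivable in KA_H, the Gamma-words of an H-closed
   language form an H'-closed one, so that
     H'*(r e) <= H*(r e) & Gamma^* = H*(e) & Gamma^* = H*(f) & Gamma^* <= H'*(r f)
   when H*(e) = H*(f).  By symmetry and completeness KA_H' proves r e = r f;
   this derivation lifts to KA_H, where e = r e and f = r f. *)

Set Implicit Arguments.
Unset Strict Implicit.
Unset Printing Implicit Defensive.
Local Open Scope classical_set_scope.

(** Pointwise form of the inclusion used in [closed_under]. Keeping both contexts explicit lets
    either factor of a product be absorbed into its neighbouring context. *)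
Definition within (X : Type) (M : language X) (u : seq X) (e : regexp X)
    (v : seq X) : Prop :=
  forall w, lang e w -> M (u ++ w ++ v).

Lemma within_plus (X : Type) (M : language X) u (x y : regexp X) v :
  within M u (x + y)%re v <-> within M u x v /\ within M u y v.
Proof.
split=> [h|[hx hy] w [/hx|/hy] //].
by split=> w hw; apply: h; [left|right].
Qed.

Lemma within_dotl (X : Type) (M : language X) u (x y : regexp X) v :
  within M u (x * y)%re v <-> forall w, lang x w -> within M (u ++ w) y v.
Proof.
split=> [h w hw w' hw'|h _ [w hw [w' hw' <-]]].
  by rewrite -catA (catA w); apply: h; exists w => //; exists w'.
by rewrite -catA catA; apply: h.
Qed.

Lemma within_dotr (X : Type) (M : language X) u (x y : regexp X) v :
  within M u (x * y)%re v <-> forall w, lang y w -> within M u x (w ++ v).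
Proof.
rewrite within_dotl.
by split=> h w hw w' hw'; have := h _ hw' _ hw; rewrite -catA.
Qed.

Lemma within_one (X : Type) (M : language X) u v :
  within M u 1%re v <-> M (u ++ v).
Proof. by split=> [h|h _ ->]; first exact: (h [::]). Qed.

Definition within_pow (X : Type) (M : language X) n u (e : regexp X) v : Prop :=
  forall w, iter n (lang_cat (lang e)) [set [::]] w -> M (u ++ w ++ v).

Lemma within_star (X : Type) (M : language X) u (e : regexp X) v :
  within M u (Star e) v <-> forall n, within_pow M n u e v.
Proof.
split=> [h n w hw|h w [n _ hw]]; last exact: h hw.
by apply: h; exists n.
Qed.

Lemma within_pow0 (X : Type) (M : language X) u (e : regexp X) v :
  within_pow M 0 u e v <-> M (u ++ v).
Proof. by split=> [h|h _ ->]; first exact: (h [::]). Qed.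

Lemma within_powS (X : Type) (M : language X) n u (e : regexp X) v :
  within_pow M n.+1 u e v <->
  forall w, lang e w -> within_pow M n (u ++ w) e v.
Proof.
split=> [h w hw w' hw'|h _ [w hw [w' hw' <-]]].
  by rewrite -catA (catA w); apply: h; exists w => //; exists w'.
by rewrite -catA catA; apply: h.
Qed.

Lemma within_star_unfold (X : Type) (M : language X) u (x : regexp X) v :
  within M u (Star x) v -> within M u (1 + x * Star x)%re v.
Proof.
move=> /within_star h; apply/within_plus; split.
  by apply/within_one/within_pow0/(h 0%N).
apply/within_dotl => w hw; apply/within_star => n.
exact: (proj1 (within_powS M n u x v) (h n.+1)).
Qed.

(** Each factor of [y] is moved into the left context, where [z] still fits by [step]; once the
    factors are used up, [step] yields [x]. *)
Lemma within_star_indl (X : Type) (M : language X) (x y z : regexp X) v :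
  (forall u, within M u z v -> within M u (x + y * z)%re v) ->
  forall u, within M u z v -> within M u (Star y * x)%re v.
Proof.
move=> step u hu; apply/within_dotl => w [n _].
elim: n u w hu => [|n IH] u w hu /=.
  by move=> ->; rewrite cats0; case/within_plus: (step _ hu).
move=> [a ha [b hb <-]]; rewrite catA; apply: IH hb.
by case/within_plus: (step _ hu) => _ /within_dotl; apply.
Qed.

Lemma within_star_indr (X : Type) (M : language X) (x y z : regexp X) u :
  (forall v, within M u y v -> within M u (x + y * z)%re v) ->
  forall v, within M u y v -> within M u (x * Star z)%re v.
Proof.
move=> step v hv; apply/within_dotr => w [n _ hw].
(* Powers are peeled from the left while the right context grows leftwards: the tail of [w] is
   absorbed first, its leading factor last. *)
suff /step /within_plus [] : within M u y (w ++ v) by [].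
elim: n w hw => [|n IH] w /=; first by move=> ->.
move=> [a ha [b hb <-]]; rewrite -catA.
by case/within_plus: (step _ (IH _ hb)) => _ /within_dotr; apply.
Qed.

Lemma closed_within (X : Type) (H : hypotheses X) (M : language X) :
  closed_under H M <->
  forall e f, H (e, f) -> forall u v, within M u f v -> within M u e v.
Proof.
split=> hM e f hef u v h.
  move=> w hw; apply: (hM e f hef u v) => [_ [w' hw' <-]|]; first exact: h.
  by exists w.
by move=> _ [w hw <-]; apply: (hM e f hef u v) hw => w' hw'; apply: h; exists w'.
Qed.

(** Induction on the derivation, for all contexts at once: the congruence rules change the context.
    The closedness of [M] enters at the rule [ka_hyp]. *)
Lemma ka_eq_sound (X : Type) (H : hypotheses X) (M : language X) :
  closed_under H M -> forall x y, ka_eq H x y ->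
  forall u v, within M u x v <-> within M u y v.
Proof.
move=> /closed_within hM x y; elim=> {x y}.
- by [].
- by move=> x y _ IH u v; rewrite IH.
- by move=> x y z _ IH1 _ IH2 u v; rewrite IH1.
- by move=> x x' y y' _ IH1 _ IH2 u v; rewrite !within_plus IH1 IH2.
- move=> x x' y y' _ IH1 _ IH2 u v.
  (* One factor is replaced at a time, the other being fixed to a word of the context. *)
  apply: (iff_trans (B := within M u (x * y')%re v)).
    by rewrite !within_dotl; split=> h w /h /IH2.
  by rewrite !within_dotr; split=> h w /h /IH1.
- move=> x x' _ IH u v; rewrite !within_star.
  (* One factor at a time: the leading factor is exchanged in front of a fixed
     word, the remaining ones by induction. *)
  have exch (a b : regexp X) :
      (forall u v, within M u a v -> within M u b v) ->
      forall n u, within_pow M n u a v -> within_pow M n u b v.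
    move=> hab; elim=> [|n IHn] u0; first by rewrite !within_pow0.
    move=> /within_powS h _ [w hw [w' hw' <-]].
    rewrite -catA; apply: (hab u0 (w' ++ v)) hw => c hc.
    by rewrite catA; apply: (IHn _ (h c hc)).
  by split=> h n; apply: exch (h n) => u' v' /IH.
- by move=> x y z u v; rewrite !within_plus; tauto.
- by move=> x y u v; rewrite !within_plus; tauto.
- by move=> x u v; rewrite within_plus; split=> [[] //|h]; split.
- by move=> x u v; rewrite within_plus; tauto.
- move=> x y z u v; rewrite within_dotl within_dotr.
  split=> h w hw.
    by apply/within_dotl => w' /h /within_dotr; apply.
  by apply/within_dotr => w' /h /within_dotl; apply.
- move=> x u v; rewrite within_dotl.
  by split=> [/(_ [::] erefl)|h _ ->]; rewrite cats0.
- move=> x u v; rewrite within_dotr.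
  by split=> [/(_ [::] erefl)|h _ ->].
- by move=> x u v; rewrite within_dotl; split=> _ w [].
- by move=> x u v; rewrite within_dotr; split=> _ w [].
- move=> x y z u v; rewrite within_plus !within_dotr.
  split=> [h|[h1 h2] w hw]; first by split=> w /h /within_plus [].
  by apply/within_plus; split; [apply: h1|apply: h2].
- move=> x y z u v; rewrite within_plus !within_dotl.
  split=> [h|[h1 h2] w hw]; first by split=> w /h /within_plus [].
  by apply/within_plus; split; [apply: h1|apply: h2].
(* From here on the rules conclude an inequation [a + b = b], which amounts to passing from [within]
   for [b] to [within] for [a]. *)
- move=> x u v; rewrite within_plus; split=> [[]//|h].
  by split=> //; apply: within_star_unfold.
- move=> x y z _ IH u v; rewrite within_plus; split=> [[]//|h].
  split=> //; apply: within_star_indl h => u' /IH.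
  by rewrite within_plus => -[].
- move=> x y z _ IH u v; rewrite within_plus; split=> [[]//|h].
  split=> //; apply: within_star_indr h => v' /IH.
  by rewrite within_plus => -[].
- move=> e f hef u v; rewrite within_plus; split=> [[]//|h].
  by split=> //; apply: hM hef _ _ h.
Qed.

(** The closure is an intersection of closed languages, and a premise about the intersection holds
    in each of them. *)
Lemma closed_hyp_closure (X : Type) (H : hypotheses X) (L : language X) :
  closed_under H (hyp_closure H L).
Proof.
apply/closed_within => e f hef u v h w hw M [hM LM].
by apply: (proj1 (closed_within H M) hM e f hef u v) hw => w' /h; apply.
Qed.

Lemma ka_eq_sub_closure (X : Type) (H : hypotheses X) (x y : regexp X) :
  ka_eq H x y -> hyp_closure H (lang x) `<=` hyp_closure H (lang y).
Proof.
move=> hxy w; apply; split; first exact: closed_hyp_closure.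
have /(ka_eq_sound (@closed_hyp_closure _ H (lang y)) hxy) h :
  within (hyp_closure H (lang y)) [::] y [::].
  by move=> w' hw'; rewrite cats0; apply: sub_gen_smallest.
by move=> w' /h; rewrite cats0.
Qed.

(** Renaming letters is a monoid morphism on words, so taking images commutes with concatenation,
    hence with all powers. *)
Lemma lang_regexp_map (X Y : Type) (h : X -> Y) (e : regexp X) :
  lang (regexp_map h e) = [set map h w | w in lang e].
Proof.
have map_cat2 (L M : language X) :
    lang_cat [set map h w | w in L] [set map h w | w in M] =
    [set map h w | w in lang_cat L M].
  apply/seteqP; split=> [_ [_ [w hw <-] [_ [w' hw' <-] <-]]|].
    by exists (w ++ w'); rewrite ?map_cat //; exists w => //; exists w'.
  move=> _ [_ [w hw [w' hw' <-]] <-]; rewrite map_cat.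
  by exists (map h w); [exists w|exists (map h w') => //; exists w'].
elim: e => [e1 IH1 e2 IH2|e1 IH1 e2 IH2|e IH|||a] /=.
- by rewrite IH1 IH2 image_setU.
- by rewrite IH1 IH2 map_cat2.
- rewrite /lang_star image_bigcup; apply: eq_bigcupr => n _.
  by rewrite IH; elim: n => [|n /= ->]; rewrite /= ?image_set1 ?map_cat2.
- by rewrite image_set0.
- by rewrite image_set1.
- by rewrite image_set1.
Qed.

Lemma lang_incl_words_over (Sigma : Type) (Gamma : set Sigma)
    (L : language (set_type Gamma)) :
  lang_incl L `<=` words_over Gamma.
Proof.
move=> _ [w _ <-]; exists (size w) => //.
elim: w => [//|a w IH] /=; exists [:: val a]; last by exists (map val w).
by exists (val a) => //; apply: set_valP.
Qed.

Lemma ka_eq_incl (Sigma : Type) (Gamma : set Sigma)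
    (H : hypotheses Sigma) (H' : hypotheses (set_type Gamma)) :
  (forall e f, H' (e, f) -> ka_le H (regexp_incl e) (regexp_incl f)) ->
  forall x y, ka_eq H' x y -> ka_eq H (regexp_incl x) (regexp_incl y).
Proof.
move=> hH' x y; elim=> {x y}; rewrite /regexp_incl /=;
  try by move=> *; constructor.
(* The rules preserved verbatim by the inclusion are settled; transitivity and the hypotheses
   remain. *)
- by move=> x y z _ hxy _; apply: ka_trans.
- by move=> e f /hH'.
Qed.

Lemma hyp_closure_incl (Sigma : Type) (Gamma : set Sigma)
    (H : hypotheses Sigma) (H' : hypotheses (set_type Gamma)) :
  (forall e f, H' (e, f) -> ka_le H (regexp_incl e) (regexp_incl f)) ->
  forall x, lang_incl (hyp_closure H' (lang x)) `<=`
            hyp_closure H (lang (regexp_incl x)).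
Proof.
move=> hH' x _ [w hw <-].
set M := hyp_closure H _.
(* Minimality of the [H']-closure is applied to the preimage of [M] under the inclusion of words. *)
apply: (hw [set w | M (map val w)]); split; last first.
  move=> w' hw'; apply: (@sub_gen_smallest _ (closed_under H)).
  by rewrite lang_regexp_map; exists w'.
apply/closed_within => e f /hH' hef u v h w' hw' /=.
have hf : within M (map val u) (regexp_incl f) (map val v).
  by move=> t; rewrite lang_regexp_map => -[t' /h ht' <-]; rewrite -!map_cat.
move: hf; rewrite -(ka_eq_sound (@closed_hyp_closure _ H _) hef) => /within_plus[he _].
by rewrite !map_cat; apply: he; rewrite lang_regexp_map; exists w'.
Qed.

Theorem theorem2p11 (Sigma : Type) (Gamma : set Sigma)
    (H : hypotheses Sigma) (H' : hypotheses (set_type Gamma)) :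
  reduces H H' -> ka_complete H' -> ka_complete H.
Proof.
move=> [hH' [r hr]] complete e f hef.
have sub (a b : regexp Sigma) :
    hyp_closure H (lang a) = hyp_closure H (lang b) ->
    hyp_closure H' (lang (r a)) `<=` hyp_closure H' (lang (r b)).
  move=> hab w hw.
  have hwi : lang_incl (hyp_closure H' (lang (r a))) (map val w) by exists w.
  have hwb : hyp_closure H (lang b) (map val w).
    rewrite -hab; apply: (ka_eq_sub_closure (ka_sym (hr a).1)).
    exact: hyp_closure_incl hwi.
  (* Condition (3) only gives some word with the same image as [w]; injectivity of [val] identifies
     the two. *)
  have [w' hw' /(inj_map val_inj) <- //] :=
    (hr b).2 _ (conj hwb (lang_incl_words_over hwi)).
have /complete /(ka_eq_incl hH') hre :
    hyp_closure H' (lang (r e)) = hyp_closure H' (lang (r f)).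
  by apply/seteqP; split; apply: sub.
exact: ka_trans (hr e).1 (ka_trans hre (ka_sym (hr f).1)).
Qed.
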